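(* Let $(M,g)$ be a Riemannian manifold with Riemann curvature tensor $R$, let $p\in M$, and let $W,X,Y,Z\in T_pM$ and $\sigma\in\mathbb{R}$. Suppose that $(W,X,Y,Z,\sigma)$ solves the singular value problem of the Riemann tensor, and that $\sigma\neq 0$. Then $$\langle W,X\rangle = 0, \qquad \langle Y,Z\rangle = 0.$$
   Context: Let $(M,g)$ be a Riemannian manifold, $\langle\cdot,\cdot\rangle = g(\cdot,\cdot)$, and $\nabla$ its Levi-Civita connection. The curvature operator is $R(X,Y) = [\nabla_X,\nabla_Y]-\nabla_{[X,Y]}$, and the $(0,4)$ curvature tensor is $R(W,Z,X,Y) := \langle W, R(X,Y)Z\rangle$ for $W,X,Y,Z\in T_pM$. Definition (singular value problem, SVP): a 5-tuple $(W,X,Y,Z,\sigma)$ with $W,X,Y,Z\in T_pM$ and $\sigma\in\mathbb{R}$ solves the singular value problem of the Riemann tensor if $$R(Y,Z)X=\sigma W,\quad R(Z,Y)W=\sigma X,\quad R(W,X)Z=\sigma Y,\quad R(X,W)Y=\sigma Z,$$ and $$\langle W,W\rangle=\langle X,X\rangle=\langle Y,Y\rangle=\langle Z,Z\rangle=1.$$ *)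

(* Defs.v *)
From HB Require Import structures.
From mathcomp Require Import all_boot all_order all_algebra.
From mathcomp Require Import all_classical all_reals all_analysis.
Import Order.TTheory GRing.Theory Num.Theory.
Import numFieldNormedType.Exports.

Set Implicit Arguments.
Unset Strict Implicit.
Unset Printing Implicit Defensive.

Local Open Scope classical_set_scope.
Local Open Scope ring_scope.

Section Smooth.
Context {R : realType} {V W : normedModType R}.

Fixpoint times_differentiable (k : nat) (U : set V) (f : V -> W) : Prop :=
  if k is k'.+1 then
    (forall x, U x -> differentiable f x) /\
    (forall v, times_differentiable k' U (fun x => 'd f x v))
  else True.

(* C^oo on U; only used for U open in a finite-dimensional space, where being
   k times differentiable for all k already makes all derivatives continuous. *)
Definition smooth_on (U : set V) (f : V -> W) : Prop :=
  forall k, times_differentiable k U f.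

End Smooth.

(* n-dimensional smooth manifolds without boundary, presented by an atlas. *)
Record smoothManifold (R : realType) (n : nat) := SmoothManifold {
  points :> topologicalType;
  manifold_hausdorff : hausdorff_space points;
  manifold_second_countable : @second_countable points;
  chart_index : Type;
  chart_dom : chart_index -> set points;
  chart : chart_index -> points -> 'rV[R]_n;
  (* meaningful only on the image of [chart_dom i] under [chart i] *)
  chart_inv : chart_index -> 'rV[R]_n -> points;
  chart_at : points -> chart_index;
  chart_domP : forall p, chart_dom (chart_at p) p;
  open_chart_dom : forall i, open (chart_dom i);
  open_chart_image : forall i, open (chart i @` chart_dom i);
  chartK : forall i p, chart_dom i p -> chart_inv i (chart i p) = p;
  chart_continuous : forall i p, chart_dom i p -> {for p, continuous (chart i)};
  chart_inv_continuous : forall i y, (chart i @` chart_dom i) y ->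
    {for y, continuous (chart_inv i)};
  chart_transition : forall i j,
    smooth_on (chart i @` (chart_dom i `&` chart_dom j))
      (chart j \o chart_inv i)
}.

Section Tangent.
Context {R : realType} {n : nat} {M : smoothManifold R n}.

(* A tangent vector at p is the family of its components in all the charts
   around p, related by the differentials of the transition maps; the
   components in the charts that do not contain p are set to 0, so that
   equality of families is equality of tangent vectors. *)
Definition tangent_pred (p : M) : {pred chart_index M -> 'rV[R]_n} :=
  [pred v | `[< (forall i, ~ chart_dom i p -> v i = 0) /\
    (forall i j, chart_dom i p -> chart_dom j p ->
      v j = 'd (chart j \o chart_inv i) (chart i p) (v i)) >] ].

Lemma tangent_submod_closed (p : M) : submod_closed (tangent_pred p).
Proof.
split; first by apply/asboolP; split => // i j _ _; rewrite linear0.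
move=> a u v /asboolP[u0 uT] /asboolP[v0 vT]; apply/asboolP.
split => [i ip | i j ip jp].
  by rewrite !fctE u0 // v0 // scaler0 addr0.
by rewrite !fctE (uT i j) // (vT i j) // linearP.
Qed.

HB.instance Definition _ (p : M) :=
  GRing.isSubmodClosed.Build R (chart_index M -> 'rV[R]_n) (tangent_pred p)
    (tangent_submod_closed p).

Record tangent (p : M) := Tangent {
  component :> chart_index M -> 'rV[R]_n;
  _ : component \in tangent_pred p
}.

HB.instance Definition _ (p : M) := [isSub for @component p].
HB.instance Definition _ (p : M) := [Choice of tangent p by <:].
HB.instance Definition _ (p : M) :=
  [SubChoice_isSubLmodule of tangent p by <:].

End Tangent.

Section Fields.
Context {R : realType} {n : nat} (M : smoothManifold R n).

Definition smooth_fun (f : M -> R) : Prop :=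
  forall i : chart_index M, smooth_on (chart i @` chart_dom i) (f \o chart_inv i).

Definition vector_field := forall p : M, tangent p.

Definition smooth_field (X : vector_field) : Prop :=
  forall i : chart_index M, smooth_on (chart i @` chart_dom i)
    (fun y => X (chart_inv i y) i).

(* X f; by the chain rule it can be computed in any chart around p. *)
Definition field_deriv (X : vector_field) (f : M -> R) : M -> R :=
  fun p => let i := chart_at p in
  'd (f \o chart_inv i) (chart i p) (X p i).

Definition is_lie_bracket (X Y B : vector_field) : Prop :=
  smooth_field B /\
  forall f, smooth_fun f ->
    forall p, field_deriv B f p =
      field_deriv X (field_deriv Y f) p - field_deriv Y (field_deriv X f) p.

(* For smooth X and Y there is exactly one B as above. *)
Definition lie_bracket (X Y : vector_field) : vector_field :=
  xget (fun p => 0) (is_lie_bracket X Y).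

Record riemannianMetric := RiemannianMetric {
  inner :> forall p : M, tangent p -> tangent p -> R;
  inner_sym : forall p (u v : tangent p), inner u v = inner v u;
  inner_linear : forall p (a : R) (u v w : tangent p),
    inner (a *: u + v) w = a * inner u w + inner v w;
  inner_pos : forall p (u : tangent p), u != 0 -> 0 < inner u u;
  inner_smooth : forall X Y : vector_field, smooth_field X -> smooth_field Y ->
    smooth_fun (fun p => inner (X p) (Y p))
}.

(* Connections and Levi-Civita connections act on smooth vector fields; the
   value of [nabla] on non-smooth fields is irrelevant. *)
Record is_connection (nabla : vector_field -> vector_field -> vector_field) :
    Prop := IsConnection {
  connection_smooth : forall X Y, smooth_field X -> smooth_field Y ->
    smooth_field (nabla X Y);
  connection_linearl : forall f X X' Y, smooth_fun f ->
    smooth_field X -> smooth_field X' -> smooth_field Y ->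
    forall p, nabla (fun q => f q *: X q + X' q) Y p =
      f p *: nabla X Y p + nabla X' Y p;
  connection_addr : forall X Y Y',
    smooth_field X -> smooth_field Y -> smooth_field Y' ->
    forall p, nabla X (fun q => Y q + Y' q) p = nabla X Y p + nabla X Y' p;
  connection_leibniz : forall f X Y, smooth_fun f ->
    smooth_field X -> smooth_field Y ->
    forall p, nabla X (fun q => f q *: Y q) p =
      f p *: nabla X Y p + field_deriv X f p *: Y p
}.

Record is_levi_civita (g : riemannianMetric)
    (nabla : vector_field -> vector_field -> vector_field) : Prop :=
  IsLeviCivita {
  levi_civita_connection : is_connection nabla;
  levi_civita_metric : forall X Y Z,
    smooth_field X -> smooth_field Y -> smooth_field Z ->
    forall p, field_deriv X (fun q => g q (Y q) (Z q)) p =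
      g p (nabla X Y p) (Z p) + g p (Y p) (nabla X Z p);
  levi_civita_torsion_free : forall X Y, smooth_field X -> smooth_field Y ->
    is_lie_bracket X Y (fun p => nabla X Y p - nabla Y X p)
}.

Definition curvature_operator
    (nabla : vector_field -> vector_field -> vector_field)
    (X Y Z : vector_field) : vector_field :=
  fun p => nabla X (nabla Y Z) p - nabla Y (nabla X Z) p
           - nabla (lie_bracket X Y) Z p.

Definition extension (p : M) (v : tangent p) : vector_field :=
  xget (fun q => 0) [set X | smooth_field X /\ X p = v].

(* R(x,y)z for tangent vectors at p: by tensoriality the choice of the smooth
   extensions is immaterial. *)
Definition curvature (nabla : vector_field -> vector_field -> vector_field)
    (p : M) (x y z : tangent p) : tangent p :=
  curvature_operator nabla (extension x) (extension y) (extension z) p.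

Definition solves_SVP (g : riemannianMetric)
    (nabla : vector_field -> vector_field -> vector_field)
    (p : M) (W X Y Z : tangent p) (sigma : R) : Prop :=
  [/\ curvature nabla Y Z X = sigma *: W,
      curvature nabla Z Y W = sigma *: X,
      curvature nabla W X Z = sigma *: Y &
      curvature nabla X W Y = sigma *: Z] /\
  [/\ g p W W = 1, g p X X = 1, g p Y Y = 1 & g p Z Z = 1].

End Fields.

(* Main.v *)
Require Import Defs.
From mathcomp Require Import all_boot all_order all_algebra.
From mathcomp Require Import all_classical all_reals all_analysis.
From mathcomp Require Import lra.
Local Open Scope ring_scope.
Import GRing.Theory Num.Theory numFieldNormedType.Exports.

(** Pairing R(Y,Z)X = sigma W with X, and R(W,X)Z = sigma Y with Z, gives
    sigma <W,X> = <R(Y,Z)X, X> and sigma <Y,Z> = <R(W,X)Z, Z>.  Both right-hand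
    sides vanish because the curvature operator of a metric connection is skew
    ([inner_curvature_diag]), and sigma can be cancelled.

    Skewness is the fact that second derivatives of the function |Z|^2 commute
    up to the bracket.  Differentiating |Z|^2 along Y and then along X gives
    2 <nabla_X nabla_Y Z, Z> + 2 <nabla_Y Z, nabla_X Z>, whose last term is
    symmetric in X and Y; hence
    2 <R(X,Y)Z, Z> = X Y |Z|^2 - Y X |Z|^2 - [X,Y] |Z|^2 = 0.

    The curvature of tangent vectors is computed on chosen fields.  The field
    chosen for a vector z is always smooth, and it either takes the value z at
    the base point or is the zero field ([extensionP]).  In the second case
    R(x,y)z = 0 by additivity, so skewness at a point follows from skewness for
    fields without constructing global extensions by bump functions. *)

Section Curvature.
Context {R : realType} {n : nat} {M : smoothManifold R n}.
Implicit Types (X Y Z : vector_field M) (f : M -> R).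

Lemma smooth_fun_differentiable f i (p : M) : smooth_fun f -> chart_dom i p ->
  differentiable (f \o chart_inv i) (chart i p).
Proof. by move=> /(_ i 1%N)[df _] ip; apply: df; exists p. Qed.

Lemma field_derivD X f f' p : smooth_fun f -> smooth_fun f' ->
  field_deriv X (fun q => f q + f' q) p =
    field_deriv X f p + field_deriv X f' p.
Proof.
move=> sf sf'; rewrite /field_deriv.
have ip := chart_domP p.
have df := smooth_fun_differentiable _ _ _ sf ip.
have df' := smooth_fun_differentiable _ _ _ sf' ip.
by have /(congr1 (fun h => h (X p (chart_at p)))) := diffD df df'.
Qed.

Lemma smooth_field0 : smooth_field (fun p : M => 0 : tangent p).
Proof.
move=> i k; rewrite (_ : (fun y => _) = fun=> 0 :> 'rV[R]_n) //.
elim: k => //= k IH; split=> [x _|v]; first exact: differentiable_cst.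
by rewrite (_ : (fun x => _) = fun=> 0) //; apply/funext => x; rewrite diff_cst.
Qed.

Lemma extension_smooth {p : M} (v : tangent p) : smooth_field (extension v).
Proof.
rewrite /extension; case: xgetP => [X _ [] //|_]; exact: smooth_field0.
Qed.

Lemma extensionP {p : M} (v : tangent p) :
  extension v p = v \/ extension v = (fun q => 0).
Proof. by rewrite /extension; case: xgetP => [X _ []|]; [left|right]. Qed.

Context {g : riemannianMetric M}.

Lemma innerDl p (u v w : tangent p) : g p (u + v) w = g p u w + g p v w.
Proof. by have := inner_linear g 1 u v w; rewrite scale1r mul1r. Qed.

Lemma inner0l p (w : tangent p) : g p 0 w = 0.
Proof. by apply: (addrI (g p 0 w)); rewrite -innerDl !addr0. Qed.

Lemma innerZl p a (u w : tangent p) : g p (a *: u) w = a * g p u w.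
Proof. by have := inner_linear g a u 0 w; rewrite inner0l !addr0. Qed.

Lemma innerBl p (u v w : tangent p) : g p (u - v) w = g p u w - g p v w.
Proof. by rewrite innerDl -scaleN1r innerZl mulN1r. Qed.

Context {nabla : vector_field M -> vector_field M -> vector_field M}.
Context (nabla_LC : is_levi_civita g nabla).

Let nabla_smooth X Y : smooth_field X -> smooth_field Y ->
  smooth_field (nabla X Y).
Proof. exact: (connection_smooth (levi_civita_connection nabla_LC)). Qed.

Lemma connection_zero X : smooth_field X ->
  nabla X (fun q => 0) = (fun q => 0).
Proof.
move=> sX; apply: functional_extensionality_dep => p.
have := connection_addr (levi_civita_connection nabla_LC) sX
  smooth_field0 smooth_field0 p.
rewrite (_ : (fun q => 0 + 0) = (fun q : M => 0 : tangent q)).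
  by move=> /(congr1 (fun u => u - nabla X (fun q => 0) p)); rewrite addrK subrr.
by apply: functional_extensionality_dep => q; rewrite addr0.
Qed.

(** Torsion-freeness exhibits a vector field representing the commutator
    X Y - Y X, so the bracket, which is defined by choice, does represent it. *)
Lemma lie_bracketP X Y : smooth_field X -> smooth_field Y ->
  is_lie_bracket X Y (lie_bracket X Y).
Proof.
move=> sX sY; apply: (xgetPex _ (P := is_lie_bracket X Y)).
by exists (fun p => nabla X Y p - nabla Y X p);
   exact: (levi_civita_torsion_free nabla_LC).
Qed.

Lemma field_deriv_sqnorm X Z p : smooth_field X -> smooth_field Z ->
  field_deriv X (fun q => g q (Z q) (Z q)) p =
    g p (nabla X Z p) (Z p) + g p (nabla X Z p) (Z p).
Proof.
by move=> sX sZ; rewrite (levi_civita_metric nabla_LC) // (inner_sym g (Z p)).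
Qed.

Lemma field_deriv2_sqnorm X Y Z p :
  smooth_field X -> smooth_field Y -> smooth_field Z ->
  field_deriv X (field_deriv Y (fun q => g q (Z q) (Z q))) p =
    (g p (nabla X (nabla Y Z) p) (Z p) +
     g p (nabla Y Z p) (nabla X Z p)) *+ 2.
Proof.
move=> sX sY sZ; have sYZ := nabla_smooth _ _ sY sZ.
have /funext -> := fun q => field_deriv_sqnorm Y Z q sY sZ.
rewrite field_derivD ?(levi_civita_metric nabla_LC) //; exact: inner_smooth.
Qed.

(** Compare the second derivatives of |Z|^2 along X and Y in both orders: the
    terms <nabla_Y Z, nabla_X Z> cancel, and what remains is the derivative of
    |Z|^2 along [X,Y]. *)
Lemma inner_curvature_operator_diag X Y Z p :
  smooth_field X -> smooth_field Y -> smooth_field Z ->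
  g p (curvature_operator nabla X Y Z p) (Z p) = 0.
Proof.
move=> sX sY sZ; have [sB brE] := lie_bracketP X Y sX sY.
have := brE _ (inner_smooth g sZ sZ) p.
rewrite field_deriv_sqnorm // !field_deriv2_sqnorm //.
rewrite /curvature_operator !innerBl (inner_sym g (nabla X Z p)).
lra.
Qed.

Lemma inner_curvature_diag p (x y z : tangent p) :
  g p (curvature nabla x y z) z = 0.
Proof.
have [sx sy] := (extension_smooth x, extension_smooth y).
rewrite /curvature; case: (extensionP z) => ez.
  rewrite -[X in g p _ X]ez; apply: inner_curvature_operator_diag => //.
  exact: extension_smooth.
have [sB _] := lie_bracketP _ _ sx sy.
by rewrite ez /curvature_operator !connection_zero // !subr0 inner0l.
Qed.

End Curvature.

Theorem proposition1 (R : realType) (n : nat) (M : smoothManifold R n)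
    (g : riemannianMetric M)
    (nabla : vector_field M -> vector_field M -> vector_field M)
    (nabla_LC : is_levi_civita g nabla)
    (p : M) (W X Y Z : tangent p) (sigma : R)
    (svp : solves_SVP g nabla W X Y Z sigma) (sigma_neq0 : sigma <> 0) :
  g p W X = 0 /\ g p Y Z = 0.
Proof.
have [[RX _ RZ _] _] := svp.
have := inner_curvature_diag nabla_LC p Y Z X.
have := inner_curvature_diag nabla_LC p W X Z.
rewrite RX RZ !innerZl => /eqP + /eqP.
by rewrite !mulf_eq0 (negPf (introN eqP sigma_neq0)) /= => /eqP ? /eqP ?.
Qed.
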